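(* Let $\mathcal{T}=(t_i)_{i=0}^\infty$ be the Thue-Morse sequence over $\mathbb{F}_2$. For every integer $N\ge 4$, the $N$th maximum order complexity of $\mathcal{T}$ satisfies $$M(\mathcal{T},N)=2^\ell+1,\qquad\text{where}\qquad \ell=\left\lceil \frac{\log (N/5)}{\log 2}\right\rceil .$$
   Context: The Thue-Morse sequence $\mathcal{T}=(t_i)_{i=0}^\infty$ over the two-element field $\mathbb{F}_2$ is defined by $t_0=0$ and, for $i=1,2,\ldots$, $t_i=t_{i/2}$ if $i$ is even and $t_i=t_{(i-1)/2}+1$ if $i$ is odd (equivalently, $t_i$ is the parity of the sum of binary digits of $i$). For a binary sequence $\mathcal{S}=(s_i)_{i=0}^\infty$ over $\mathbb{F}_2$ and a positive integer $N$, the $N$th maximum order complexity $M(\mathcal{S},N)$ is defined as follows. If $(s_0,\ldots,s_{N-2})$ is not a constant tuple $(a,\ldots,a)$ with $a\in\{0,1\}$, then $M(\mathcal{S},N)$ is the smallest positive integer $M$ such that there is a polynomial $f(x_1,\ldots,x_M)\in\mathbb{F}_2[x_1,\ldots,x_M]$ with $$s_{i+M}=f(s_i,s_{i+1},\ldots,s_{i+M-1}),\quad 0\le i\le N-M-1.$$ If $s_i=a$ for all $i=0,\ldots,N-2$, then $M(\mathcal{S},N)=0$ if $s_{N-1}=a$ and $M(\mathcal{S},N)=N-1$ if $s_{N-1}\ne a$. *)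

(* Defs.v *)
From mathcomp Require Import all_boot all_order all_algebra.
From mathcomp Require Import mpoly boolp.

Set Implicit Arguments.
Unset Strict Implicit.
Unset Printing Implicit Defensive.

Import GRing.Theory.
Local Open Scope ring_scope.

(* [k] only bounds the number of halvings: any [k >= i] gives the same value. *)
Fixpoint thue_morse_rec (k i : nat) : 'F_2 :=
  if k is k'.+1 then thue_morse_rec k' i./2 + (odd i)%:R else 0.

Definition thue_morse (i : nat) : 'F_2 := thue_morse_rec i i.

Lemma thue_morse_rec_bound k i :
  (i <= k)%N -> thue_morse_rec k i = thue_morse i.
Proof.
rewrite /thue_morse.
suff H : forall k l j, (j <= k)%N -> (j <= l)%N ->
    thue_morse_rec k j = thue_morse_rec l j by move=> ik; apply: H.
have H0 : forall l, thue_morse_rec l 0 = 0.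
  by elim=> //= l ->; rewrite addr0.
have half_le j m : (j <= m.+1)%N -> (j./2 <= m)%N.
  by move=> /half_leq /leq_trans; apply; rewrite leq_uphalf_double -addnn leq_addr.
elim=> [|k' IH] [|l] j //.
- by rewrite leqn0 => /eqP -> _; rewrite !H0.
- by move=> _; rewrite leqn0 => /eqP ->; rewrite !H0.
- by move=> jk jl /=; rewrite (IH l) ?half_le.
Qed.

Lemma thue_morse0 : thue_morse 0 = 0.
Proof. by []. Qed.

Lemma thue_morse_even i :
  (0 < i)%N -> ~~ odd i -> thue_morse i = thue_morse i./2.
Proof.
case: i => // i _ ev.
rewrite {1}/thue_morse [LHS]/= -/(odd i.+1) (negbTE ev) addr0.
by apply: thue_morse_rec_bound; rewrite leq_uphalf_double -addnn leq_addr.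
Qed.

Lemma thue_morse_odd i :
  odd i -> thue_morse i = thue_morse (i.-1)./2 + 1.
Proof.
case: i => // i od.
rewrite {1}/thue_morse [LHS]/= -/(odd i.+1) od.
have -> : uphalf i = i./2 by rewrite uphalf_half; move: od => /= /negbTE ->.
by congr (_ + _); apply: thue_morse_rec_bound; rewrite leq_half_double leqW // -addnn leq_addr.
Qed.

(* [s_(i+M) = f(s_i, ..., s_(i+M-1))] for [0 <= i <= N - M - 1]; the bound is
   written [i + M < N] to avoid truncated subtraction, so that the condition
   is vacuous when [N <= M]. *)
Definition has_recurrence (s : nat -> 'F_2) (N M : nat) : Prop :=
  exists f : {mpoly 'F_2[M]},
    forall i : nat, (i + M < N)%N -> s (i + M)%N = f.@[fun j : 'I_M => s (i + j)%N].

Lemma has_recurrence_exists (s : nat -> 'F_2) (N : nat) :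
  exists M : nat, (0 < M)%N && `[< has_recurrence s N M >].
Proof.
exists N.+1; apply/asboolP; exists 0 => i.
by rewrite addnS ltnNge leqW // leq_addl.
Qed.

(* If [s_0, ..., s_(N-2)] is constant then its value is [s_0]; for [N = 1] this
   tuple is empty and the value is 0. The value at [N = 0] is meaningless. *)
Definition max_order_complexity (s : nat -> 'F_2) (N : nat) : nat :=
  if [forall i : 'I_N.-1, s i == s 0%N] then
    if s N.-1 == s 0%N then 0%N else N.-1
  else ex_minn (has_recurrence_exists s N).

(* Main.v *)
(* Every map F_2^M -> F_2 is a polynomial, so a recurrence of order M fails
   exactly when two equal windows of length M are followed by different terms.
   With l >= 1 and K = 2^(l-1), the windows of length 2^l at 0 and 3K agree
   while t_(2K) <> t_(5K), so order 2^l fails as soon as N > 5K. Conversely two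
   equal windows of length 2^l + 1 starting before 4 * 2^l - 1 have equal
   successors, by induction on l: a window of length 5 determines the parity of
   its position, hence equal windows desubstitute along 0 -> 01, 1 -> 10. *)
Require Import Defs.
From mathcomp Require Import all_boot all_order all_algebra.
From mathcomp Require Import reals exp.
From mathcomp Require Import mpoly boolp zify.
Local Open Scope ring_scope.

Import Order.TTheory GRing.Theory Num.Theory.

Lemma F2_addr11 (x : 'F_2) : x + 1 + 1 = x.
Proof. by case: x => [[|[|]]] // ?; apply: val_inj. Qed.

Lemma F2_addr1_neq (x : 'F_2) : x <> x + 1.
Proof. by case: x => [[|[|]]] // ? /(congr1 val). Qed.

Lemma F2_indicator (x a : 'F_2) : 1 - (x - a) = (x == a)%:R.
Proof.
by case: x => [[|[|]]] // ?; case: a => [[|[|]]] // ?; apply: val_inj.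
Qed.

(* Lagrange interpolation: [1 - (x - a)] is the indicator of [x = a]. *)
Lemma F2_fun_mpoly (M : nat) (c : {ffun 'I_M -> 'F_2} -> 'F_2) :
  exists f : {mpoly 'F_2[M]},
    forall v : 'I_M -> 'F_2, f.@[v] = c [ffun j => v j].
Proof.
exists (\sum_(a : {ffun 'I_M -> 'F_2}) (c a)%:MP *
    \prod_j (1 - ('X_j - (a j)%:MP))).
move=> v; rewrite raddf_sum (bigD1 [ffun j => v j]) //= [X in _ + X]big1 ?addr0.
  rewrite mevalM mevalC rmorph_prod /= big1 ?mulr1 // => j _.
  by rewrite !mevalB meval1 mevalXU mevalC F2_indicator ffunE eqxx.
move=> a av; rewrite mevalM mevalC rmorph_prod /=.
have [j vj] : exists j, v j != a j.
  apply/existsP; apply: contraNT av; rewrite negb_exists => /forallP va.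
  by apply/eqP/ffunP => j; rewrite ffunE; move/eqP: (negPn (va j)).
rewrite (bigD1 j) //= !mevalB meval1 mevalXU mevalC.
by rewrite F2_indicator (negbTE vj) mul0r mulr0.
Qed.

Lemma has_recurrenceP (s : nat -> 'F_2) (N M : nat) :
  has_recurrence s N M <->
  forall i j : nat, (i + M < N)%N -> (j + M < N)%N ->
    (forall k, (k < M)%N -> s (i + k)%N = s (j + k)%N) ->
    s (i + M)%N = s (j + M)%N.
Proof.
split=> [[f fP] i j iN jN ij|H].
  rewrite fP // fP //; congr (meval _ _).
  by apply/funext => k; apply: ij.
pose P (a : {ffun 'I_M -> 'F_2}) (i : 'I_N) :=
  (i + M < N)%N && [forall k : 'I_M, s (i + k)%N == a k].
(* A window is sent to the successor of any of its occurrences, and to 0 if it never occurs. *)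
have [f fP] := @F2_fun_mpoly M
  (fun a => if [pick i | P a i] is Some i then s (i + M)%N else 0).
exists f => i iN; rewrite fP; case: pickP => [j /andP[jN /forallP ja]|no].
  apply: H => // k kM; move/eqP: (ja (Ordinal kM)); rewrite ffunE /= => -> //.
have iN' : (i < N)%N by exact: leq_ltn_trans (leq_addr _ _) iN.
have := no (Ordinal iN'); rewrite /P /= iN /= => /negbT/negP[].
by apply/forallP => k; rewrite ffunE.
Qed.

Lemma thue_morse_double n : thue_morse n.*2 = thue_morse n.
Proof.
case: n => // n; rewrite thue_morse_even ?double_gt0 ?odd_double //.
by rewrite doubleK.
Qed.

Lemma thue_morse_doubleS n : thue_morse n.*2.+1 = thue_morse n + 1.
Proof. by rewrite thue_morse_odd /= ?odd_double // doubleK. Qed.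

(** One of the two adjacent pairs starts at an even position [2b], where the terms are [t_b] and
    [t_b + 1]. *)
Lemma thue_morse_no_cube1 a :
  thue_morse a = thue_morse a.+1 -> thue_morse a.+1 = thue_morse a.+2 -> False.
Proof.
rewrite -(odd_double_half a); set b := a./2.
case: (odd a); rewrite ?add0n ?add1n.
  by rewrite -!doubleS !(thue_morse_double, thue_morse_doubleS) => _ e; apply: F2_addr1_neq e.
by rewrite thue_morse_doubleS thue_morse_double => e _; apply: F2_addr1_neq e.
Qed.

(* A common window of length 5 at an even and at an odd position would be
   alternating, hence come from three equal consecutive terms. *)
Lemma thue_morse_window5_parity a b :
  (forall k, (k < 5)%N -> thue_morse (a.*2 + k)%N = thue_morse (b.*2.+1 + k)%N) ->
  False.
Proof.
move=> H.
have := H 0%N isT; have := H 1%N isT; have := H 2%N isT.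
have := H 3%N isT; have := H 4%N isT.
rewrite !addn0.
have -> : (a.*2 + 4 = a.+2.*2)%N by lia.
have -> : (a.*2 + 3 = a.+1.*2.+1)%N by lia.
have -> : (a.*2 + 2 = a.+1.*2)%N by lia.
have -> : (a.*2 + 1 = a.*2.+1)%N by lia.
have -> : (b.*2.+1 + 4 = b.+2.*2.+1)%N by lia.
have -> : (b.*2.+1 + 3 = b.+2.*2)%N by lia.
have -> : (b.*2.+1 + 2 = b.+1.*2.+1)%N by lia.
have -> : (b.*2.+1 + 1 = b.+1.*2)%N by lia.
rewrite !(thue_morse_double, thue_morse_doubleS) => h4 h3 h2 h1 _.
apply: (@thue_morse_no_cube1 a).
  by rewrite h2 -h1 F2_addr11.
by rewrite h4 -h3 F2_addr11.
Qed.

Lemma window_determines_next_check (s : nat -> 'F_2) (n m i j : nat) :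
  all (fun a => all (fun b =>
      all (fun k => s (a + k)%N == s (b + k)%N) (iota 0 m) ==>
      (s (a + m)%N == s (b + m)%N)) (iota 0 n)) (iota 0 n) ->
  (i < n)%N -> (j < n)%N ->
  (forall k, (k < m)%N -> s (i + k)%N = s (j + k)%N) ->
  s (i + m)%N = s (j + m)%N.
Proof.
move=> /allP sP ni nj sij.
have /allP/(_ j) := sP i ltac:(by rewrite mem_iota).
rewrite mem_iota => /(_ nj)/implyP H.
by apply/eqP/H/allP => k; rewrite mem_iota => /sij ->.
Qed.

Lemma thue_morse_window_determines_next l i j :
  (i + 1 < 4 * 2 ^ l)%N -> (j + 1 < 4 * 2 ^ l)%N ->
  (forall k, (k < 2 ^ l + 1)%N -> thue_morse (i + k)%N = thue_morse (j + k)%N) ->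
  thue_morse (i + (2 ^ l + 1))%N = thue_morse (j + (2 ^ l + 1))%N.
Proof.
(* Two base cases: the parity argument needs [2 * m + 1 >= 5], that is [m >= 2]. *)
elim: l i j => [|[|l] IHl] i j.
- by rewrite !addn1; apply: (@window_determines_next_check _ 3 2); vm_compute.
- by rewrite !addn1; apply: (@window_determines_next_check _ 7 3); vm_compute.
rewrite expnS; set m := (2 ^ l.+1)%N in IHl *.
have m2 : (2 <= m)%N by rewrite /m expnS; have := expn_gt0 2 l; lia.
rewrite -(odd_double_half i) -(odd_double_half j).
move: (i./2) (j./2) => a b ia jb H.
have H5 k : (k < 5)%N ->
    thue_morse (odd i + a.*2 + k)%N = thue_morse (odd j + b.*2 + k)%N.
  by move=> k5; apply: H; lia.
case: (odd i) (odd j) ia jb H H5 => [] [] /=; rewrite ?add0n ?add1n.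
(* Both starts odd: the odd positions of the window spell the complements of [m + 1] consecutive
   terms from [a], and the next term is [t_(a+m+1)]. *)
- move=> ia jb H _.
  have -> : (a.*2.+1 + (2 * m + 1) = (a + (m + 1)).*2)%N by lia.
  have -> : (b.*2.+1 + (2 * m + 1) = (b + (m + 1)).*2)%N by lia.
  rewrite !thue_morse_double; apply: IHl; [lia|lia|] => k km.
  apply: (addIr 1); rewrite -!thue_morse_doubleS.
  have := H (k.*2) ltac:(lia).
  by rewrite !doubleD !addSn.
- by move=> _ _ _ H5; case: (@thue_morse_window5_parity b a) => k /H5.
- by move=> _ _ _ /thue_morse_window5_parity.
(* Both starts even: the next term is the complement of the last term of the window. *)
- move=> _ _ H _.
  have -> : (a.*2 + (2 * m + 1) = (a + m).*2.+1)%N by lia.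
  have -> : (b.*2 + (2 * m + 1) = (b + m).*2.+1)%N by lia.
  rewrite !thue_morse_doubleS -[thue_morse (a + m)]thue_morse_double.
  rewrite -[thue_morse (b + m)]thue_morse_double !doubleD.
  by congr (_ + _); apply: H; lia.
Qed.

(** The [l]-fold image under 0 -> 01, 1 -> 10 of [t_0 t_1 = t_3 t_4]. *)
Lemma thue_morse_repeat l k : (k < 2 * 2 ^ l)%N ->
  thue_morse (3 * 2 ^ l + k)%N = thue_morse k.
Proof.
elim: l k => [|l IHl] k; first by case: k => [|[|k]] // _; apply: val_inj.
rewrite -(odd_double_half k) expnS => kl.
have -> : (3 * (2 * 2 ^ l) + (odd k + k./2.*2) =
           odd k + (3 * 2 ^ l + k./2).*2)%N by lia.
have kl' : (k./2 < 2 * 2 ^ l)%N by lia.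
by case: (odd k); rewrite ?add0n ?add1n !(thue_morse_double, thue_morse_doubleS) IHl.
Qed.

Lemma thue_morse_mul_exp2 a l : thue_morse (a * 2 ^ l)%N = thue_morse a.
Proof.
elim: l => [|l IHl]; first by rewrite muln1.
by rewrite expnS mulnCA mul2n thue_morse_double.
Qed.

(** With [K = 2 ^ l], windows ending just before [2K] and [5K] treat all orders [M <= 2K] at
    once. *)
Lemma thue_morse_no_recurrence l N M :
  (5 * 2 ^ l < N)%N -> (M <= 2 * 2 ^ l)%N -> ~ has_recurrence thue_morse N M.
Proof.
move=> lN Ml /has_recurrenceP H.
have := H (2 * 2 ^ l - M)%N (5 * 2 ^ l - M)%N.
rewrite !subnK //; last by lia.
rewrite !thue_morse_mul_exp2 => /(_ ltac:(lia) ltac:(lia)) H'.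
suff /(congr1 val) : thue_morse 2 = thue_morse 5 by [].
apply: H' => k kM.
have -> : (5 * 2 ^ l - M + k = 3 * 2 ^ l + (2 * 2 ^ l - M + k))%N by lia.
by rewrite thue_morse_repeat //; lia.
Qed.

(** Serves the exponent 0, where [2 ^ l = 1] is odd: [t_1 = t_2] but [t_2 <> t_3]. *)
Lemma thue_morse_no_recurrence1 N M :
  (4 <= N)%N -> (M <= 1)%N -> ~ has_recurrence thue_morse N M.
Proof.
move=> N4 M1 /has_recurrenceP H.
have := H (2 - M)%N (3 - M)%N; rewrite !subnK //; try lia.
move=> /(_ ltac:(lia) ltac:(lia)) H'.
suff /(congr1 val) : thue_morse 2 = thue_morse 3 by [].
by apply: H'; case: M M1 {H} => [|[|M]] // _ [|k] // _; apply: val_inj.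
Qed.

Lemma max_order_complexity_thue_morse N l :
  (4 <= N)%N -> (5 * 2 ^ l < 2 * N)%N -> (N <= 5 * 2 ^ l)%N ->
  max_order_complexity thue_morse N = (2 ^ l + 1)%N.
Proof.
move=> N4 lN Nl; rewrite /max_order_complexity.
have N1 : (1 < N.-1)%N by lia.
(* The tuple is not constant, since [t_1 <> t_0]. *)
case: ifPn => [/forallP /(_ (Ordinal N1)) //|_].
case: ex_minnP => M /andP[M0 /asboolP HM] minM.
apply/eqP; rewrite eqn_leq; apply/andP; split.
  apply: minM; apply/andP; split; first by rewrite addn1.
  apply/asboolP/has_recurrenceP => i j iN jN.
  (* From [i + 2 ^ l + 1 < N <= 5 * 2 ^ l] follows [i + 1 < 4 * 2 ^ l]. *)
  by apply: thue_morse_window_determines_next; lia.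
rewrite addn1 ltnNge; apply/negP; move: HM.
case: l lN Nl => [|l] lN Nl HM Ml; first exact: thue_morse_no_recurrence1 HM.
by rewrite expnS in lN Ml; apply: thue_morse_no_recurrence HM; last exact: Ml; lia.
Qed.

Lemma exp2_bracket N : (3 <= N)%N ->
  exists2 l, (5 * 2 ^ l < 2 * N)%N & (N <= 5 * 2 ^ l)%N.
Proof.
move=> N3.
have ex : exists l, (N <= 5 * 2 ^ l)%N.
  by exists N; have := ltn_expl N (isT : (1 < 2)%N); lia.
case: (ex_minnP ex) => l Nl minl; exists l => //.
(* For [l = 0] the lower bound reads [5 < 2 * N]; otherwise it is the minimality of [l]. *)
case: l Nl minl => [|l] _ minl; first by lia.
by rewrite expnS; have := minl l; lia.
Qed.

(** Logarithms turn the bracket into [l - 1 < ln x / ln 2 <= l]; it is applied to [x = N / 5]. *)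
Lemma ceil_ln_div_ln2 (R : realType) (x : R) (l : nat) :
  2 ^+ l < 2 * x -> x <= 2 ^+ l -> Num.ceil (ln x / ln 2) = l%:Z.
Proof.
move=> lx xl.
have ln2 : 0 < ln (2 : R) by rewrite ln_gt0 // ltr1n.
have x0 : 0 < x by rewrite -(pmulr_rgt0 _ (ltr0n R 2)) (lt_trans _ lx) ?exprn_gt0.
have lnX : ln (2 ^+ l : R) = l%:R * ln 2 by rewrite lnXn // mulr_natl.
apply: ceil_def; apply/andP; split.
  rewrite ltr_pdivlMr // rmorphB /= mulrBl mul1r -lnX ltrBlDl.
  by rewrite -lnM ?posrE // ltr_ln ?posrE // ?exprn_gt0 ?mulr_gt0.
by rewrite ler_pdivrMr // -lnX ler_ln ?posrE // exprn_gt0.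
Qed.

Theorem theorem1 (R : realType) (N : nat) (hN : (4 <= N)%N) :
  (max_order_complexity thue_morse N)%:R
    = 2 ^ Num.ceil (ln (N%:R / 5 : R) / ln (2 : R)) + 1 :> R.
Proof.
have [l lN Nl] := exp2_bracket N (ltnW hN).
rewrite (max_order_complexity_thue_morse N l) // (ceil_ln_div_ln2 _ _ l).
- by rewrite natrD natrX.
- by rewrite mulrA ltr_pdivlMr // mulrC -natrX -!natrM ltr_nat.
- by rewrite ler_pdivrMr // mulrC -natrX -natrM ler_nat.
Qed.
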